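(* Let $G$ be a transitive permutation group of degree $d$ which can be generated by $k$ elements. Then there exist an alphabet $A$ with $k$ letters and a finite bifix code $X\subset A^+$ with $\mathrm{Card}(X)=(k-1)d+1$ such that $G$ is (equivalent, as a permutation group, to) a syntactic group of $X$.
   Context: A bifix code is a set of nonempty words none of which is a proper prefix or proper suffix of another. The minimal automaton of a set $L\subset A^*$ has as states the nonempty sets $u^{-1}L=\{v\mid uv\in L\}$, initial state $L$, and transitions $u^{-1}L\cdot a=(ua)^{-1}L$ (undefined if empty); each word $w$ induces a partial map $q\mapsto q\cdot w$ on states, and these maps form the transition monoid. A group in a monoid $M$ is a subsemigroup isomorphic to a group; it is maximal if not contained in another group in $M$. In a monoid of partial maps, all elements of such a group have a common image $I$ and their restrictions to $I$ are permutations, giving a faithful permutation representation on $I$ (the canonical representation). A syntactic group of a prefix code $X$ is the canonical representation of a maximal group in the transition monoid of the minimal automaton of $X^*$. Two permutation groups $G$ on $R$ and $H$ on $S$ are equivalent if there is a bijection $\beta:R\to S$ and an isomorphism $\sigma:G\to H$ with $\beta(rg)=\beta(r)\sigma(g)$ for all $r,g$. The degree of a permutation group is the size of the set it acts on; it is transitive if any point can be mapped to any other. *)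

(* Defs.v *)
From HB Require Import structures.
From mathcomp Require Import all_boot all_order all_algebra all_fingroup.
From Stdlib Require Import ClassicalEpsilon FunctionalExtensionality.
Set Implicit Arguments. Unset Strict Implicit. Unset Printing Implicit Defensive.

Definition bifix_code (A : eqType) (X : seq (seq A)) : Prop :=
  (forall x, x \in X -> x != [::]) /\
  (forall x y, x \in X -> y \in X -> prefix x y -> x = y) /\
  (forall x y, x \in X -> y \in X -> suffix x y -> x = y).

Definition lang (A : Type) := seq A -> Prop.

Definition star (A : eqType) (X : seq (seq A)) : lang A :=
  fun w => exists s : seq (seq A), all (fun x => x \in X) s /\ flatten s = w.

Definition resid (A : Type) (L : lang A) (u : seq A) : lang A :=
  fun v => L (u ++ v).

Definition nonempty_lang (A : Type) (L : lang A) : Prop := exists v, L v.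

(* States of the minimal automaton of L: nonempty sets u^{-1}L. *)
Definition is_state (A : Type) (L : lang A) (q : lang A) : Prop :=
  (exists u, q = resid L u) /\ nonempty_lang q.

Definition state (A : Type) (L : lang A) := {q : lang A | is_state L q}.

Lemma resid_is_state (A : Type) (L : lang A) (q : lang A) (w : seq A) :
  is_state L q -> nonempty_lang (resid q w) -> is_state L (resid q w).
Proof.
move=> [[u ->] _] Hne; split=> //; exists (u ++ w).
by rewrite /resid; apply: functional_extensionality => v; rewrite catA.
Qed.

Definition act (A : Type) (L : lang A) (w : seq A) (q : state L) : option (state L) :=
  match excluded_middle_informative (nonempty_lang (resid (sval q) w)) with
  | left H => Some (exist _ (resid (sval q) w) (@resid_is_state A L (sval q) w (proj2_sig q) H))
  | right _ => None
  end.

Definition trans_monoid (A : Type) (L : lang A) : (state L -> option (state L)) -> Prop :=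
  fun f => exists w : seq A, f = @act A L w.

(* composition "first f, then g" (right action: q.(uv) = (q.u).v) *)
Definition pcomp (S : Type) (f g : S -> option S) : S -> option S :=
  fun s => obind g (f s).

Definition is_group_in (S : Type) (M H : (S -> option S) -> Prop) : Prop :=
  (forall h, H h -> M h) /\
  (forall h1 h2, H h1 -> H h2 -> H (pcomp h1 h2)) /\
  exists e, [/\ H e,
     (forall h, H h -> pcomp e h = h /\ pcomp h e = h) &
     (forall h, H h -> exists h', [/\ H h', pcomp h h' = e & pcomp h' h = e])].

Definition is_maximal_group_in (S : Type) (M H : (S -> option S) -> Prop) : Prop :=
  is_group_in M H /\
  forall H', is_group_in M H' -> (forall h, H h -> H' h) -> forall h, H' h -> H h.

Definition group_image (S : Type) (H : (S -> option S) -> Prop) (s : S) : Prop :=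
  forall h, H h -> exists s0, h s0 = Some s.

(* The permutation group G on T is equivalent to the canonical representation
   of H (on its common image I): a bijection beta : T -> I and an isomorphism
   sigma : G -> H with beta(t g) = beta(t) . sigma(g).  (The restriction map
   h |-> h|_I is an isomorphism of H onto its canonical representation, so we
   let sigma take values directly in H.) *)
Definition perm_equiv_canonical (T : finType) (G : {group {perm T}}) (S : Type)
    (H : (S -> option S) -> Prop) : Prop :=
  exists (beta : T -> S) (sigma : {perm T} -> (S -> option S)),
    injective beta /\
    (forall s, group_image H s <-> exists t, beta t = s) /\
    (forall g, g \in G -> H (sigma g)) /\
    {in G &, injective sigma} /\
    (forall h, H h -> exists2 g, g \in G & sigma g = h) /\
    {in G &, forall g1 g2, sigma (g1 * g2)%g = pcomp (sigma g1) (sigma g2)} /\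
    (forall t g, g \in G -> sigma g (beta t) = Some (beta (g t))).

Definition is_syntactic_group (T : finType) (G : {group {perm T}}) (A : eqType)
    (X : seq (seq A)) : Prop :=
  exists H, is_maximal_group_in (@trans_monoid A (star X)) H /\ perm_equiv_canonical G H.

(* Main.v *)
(* Let the letters act on T as the given generators and fix a point o. The words
   fixing o whose proper nonempty suffixes do not fix o form a bifix code Z, which
   is infinite in general; X is the set of words of Z that are factors of the
   words ...vvv u_j vvv..., for words v = u_i and u_j obtained from the letters by
   a product of substitutions rho_i : i -> i, j -> ij. The words preceded by
   several letters in this set of factors are the prefixes of vvv..., and each of
   them can be preceded by all k letters.
   The substitutions are chosen so that u_j still acts as the j-th generator and
   that reading a power of v from any point passes through o. Then X is finite,
   its tree of suffixes has exactly d branching nodes, all of degree k, and hence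
   it has (k-1)d+1 leaves. In the minimal automaton of X^*, a power V of v that
   acts trivially on T is an idempotent whose image is in bijection with T, and
   V u_j V acts on that image as the j-th generator. *)
Require Import Defs.
From HB Require Import structures.
From mathcomp Require Import all_boot all_order all_algebra all_fingroup.
From mathcomp Require Import cyclic zify.
From Stdlib Require Import ClassicalEpsilon FunctionalExtensionality.
From Stdlib Require Import PropExtensionality ProofIrrelevance.
Set Implicit Arguments. Unset Strict Implicit. Unset Printing Implicit Defensive.
(* [Defs] is imported again because ssrfun also defines a [pcomp]. *)
Import Defs GRing.Theory.

(** * Maximal groups in a monoid of partial maps *)

Section Partial.
Variable S : Type.
Implicit Types (f g h e : S -> option S) (M H : (S -> option S) -> Prop).

Lemma pcompA f g h : pcomp f (pcomp g h) = pcomp (pcomp f g) h.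
Proof. apply: functional_extensionality => s; by rewrite /pcomp; case: (f s). Qed.

(** For an idempotent [e] this is the group of units of the local monoid [e M e], that is, the
    H-class of [e]. *)
Definition unit_group M e : (S -> option S) -> Prop := fun h =>
  [/\ M h, pcomp e h = h, pcomp h e = h &
      exists h', [/\ M h', pcomp e h' = h', pcomp h' e = h',
                     pcomp h h' = e & pcomp h' h = e]].

(** A larger group contains the idempotent [e], which must be its identity, so all its elements are
    units of [e M e]. *)
Lemma unit_group_maximal M e :
  (forall f g, M f -> M g -> M (pcomp f g)) -> M e -> pcomp e e = e ->
  is_maximal_group_in M (unit_group M e).
Proof.
move=> MM Me ee; have He : unit_group M e e by split=> //; exists e.
split.
  split; first by move=> h [].
  split.
    move=> h1 h2 [M1 l1 r1 [k1 [Mk1 lk1 rk1 a1 b1]]] [M2 l2 r2 [k2 [Mk2 lk2 rk2 a2 b2]]].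
    split; [exact: MM|by rewrite pcompA l1|by rewrite -pcompA r2|].
    exists (pcomp k2 k1); split; first exact: MM.
    - by rewrite pcompA lk2.
    - by rewrite -pcompA rk1.
    - by rewrite -pcompA (pcompA h2) a2 lk1 a1.
    - by rewrite -pcompA (pcompA k1) b1 l2 b2.
  exists e; split=> //.
    by move=> h [].
  move=> h [Mh lh rh [k [Mk lk rk a b]]]; exists k; split=> //.
  by split=> //; exists h.
move=> H' [H'M [H'c [e' [He' ide' inv']]]] sub h Hh.
have He'e := sub _ He.
have e'e : e' = e.
  have [k [Hk ek ke]] := inv' _ He'e.
  by rewrite -[RHS](ide' _ He'e).2 -{2}ek pcompA ee.
subst e'; have [l r] := ide' _ Hh; have [k [Hk hk kh]] := inv' _ Hh.
split=> //; first exact: H'M.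
exists k; have [lk rk] := ide' _ Hk.
by split=> //; apply: H'M.
Qed.

End Partial.

(** * Residuals and the action of words on the minimal automaton *)

Section MinimalAutomaton.
Variables (A : Type) (L : lang A).

Lemma lang_ext (K K' : lang A) : (forall w, K w <-> K' w) -> K = K'.
Proof.
move=> KK'; apply: functional_extensionality => w.
exact: propositional_extensionality.
Qed.

Lemma resid_cat (K : lang A) u w : resid K (u ++ w) = resid (resid K u) w.
Proof. apply: lang_ext => y; by rewrite /resid catA. Qed.

Lemma state_eq (q q' : state L) : sval q = sval q' -> q = q'.
Proof. by case: q q' => [q Hq] [q' Hq'] /= ?; exact: subset_eq_compat. Qed.

Lemma actP w (q q' : state L) :
  act w q = Some q' <-> sval q' = resid (sval q) w.
Proof.
rewrite /act; case: excluded_middle_informative => [ne|em]; split.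
- by case=> <-.
- by move=> E; congr Some; apply: state_eq.
- by [].
- by move=> E; case: em; rewrite -E; case: (proj2_sig q').
Qed.

Lemma act_cat u w : act (u ++ w) = pcomp (act u) (act w) :> (state L -> _).
Proof.
apply: functional_extensionality => q; rewrite /pcomp.
case E: (act u q) => [q1|] /=.
  have {E}/actP E := E.
  case E1: (act w q1) => [q2|].
    by apply/actP; rewrite resid_cat -E; apply/actP.
  case E2: (act (u ++ w) q) => [q2|] //.
  have {E2}/actP E2 := E2.
  by rewrite resid_cat -E in E2; move/actP: E2; rewrite E1.
case E2: (act (u ++ w) q) => [q2|] //.
have {E2}/actP E2 := E2.
move: E; rewrite /act; case: excluded_middle_informative => // -[].
have [_ [y]] := proj2_sig q2; rewrite E2 => Ly; exists (w ++ y).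
by move: Ly; rewrite /resid catA.
Qed.

End MinimalAutomaton.

(** * Powers of words, and words acting as permutations *)

Definition power (A : Type) (w : seq A) n : seq A := flatten (nseq n w).

Lemma powerS (A : Type) (w : seq A) n : power w n.+1 = w ++ power w n.
Proof. by []. Qed.

Lemma powerD (A : Type) (w : seq A) m n : power w (m + n) = power w m ++ power w n.
Proof. by rewrite /power nseqD flatten_cat. Qed.

Lemma power1 (A : Type) (w : seq A) : power w 1 = w.
Proof. exact: cats0. Qed.

Lemma powerSr (A : Type) (w : seq A) n : power w n.+1 = power w n ++ w.
Proof. by rewrite -addn1 powerD power1. Qed.

Lemma powerM (A : Type) (w : seq A) m n : power (power w m) n = power w (m * n).
Proof. by elim: n => [|n IH]; rewrite ?muln0 // mulnS powerD powerS IH. Qed.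

Lemma size_power (A : Type) (w : seq A) n : size (power w n) = n * size w.
Proof. by elim: n => // n IH; rewrite powerS size_cat IH mulSn. Qed.

Section Run.
Variables (T : finType) (A : finType) (g : A -> {perm T}).
Implicit Types (t : T) (w : seq A).

Definition run t w := foldl (fun s c => g c s) t w.

Definition wperm w : {perm T} := (\prod_(c <- w) g c)%g.

Lemma run_cat t w w' : run t (w ++ w') = run (run t w) w'.
Proof. exact: foldl_cat. Qed.

Lemma runE t w : run t w = wperm w t.
Proof.
elim: w t => [|c w IH] t; first by rewrite /wperm big_nil perm1.
by rewrite /= IH /wperm big_cons permM.
Qed.

Lemma run_inj w : injective (run ^~ w).
Proof. by move=> t t'; rewrite !runE => /perm_inj. Qed.

Lemma wperm_in (G : {group {perm T}}) w : (forall c, g c \in G) -> wperm w \in G.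
Proof. by move=> gG; apply: group_prod => c _. Qed.

Lemma wperm_cat w w' : wperm (w ++ w') = (wperm w * wperm w')%g.
Proof. exact: big_cat. Qed.

Lemma wperm_power w n : wperm (power w n) = (wperm w ^+ n)%g.
Proof.
elim: n => [|n IH]; first by rewrite /wperm big_nil.
by rewrite powerS wperm_cat IH expgS.
Qed.

Lemma run_power_card w n t : run t (power w (#|[set: {perm T}]| * n)) = t.
Proof.
rewrite runE wperm_power expgM.
have /expg_cardG -> : wperm w \in [set: {perm T}]%G by rewrite inE.
by rewrite expg1n perm1.
Qed.

Fixpoint hits (o t : T) w : bool :=
  (t == o) || (if w is c :: w' then hits o (g c t) w' else false).

Lemma hitsP o t w : reflect (exists p q, w = p ++ q /\ run t p = o) (hits o t w).
Proof.
elim: w t => [|c w IH] t /=.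
  rewrite orbF; apply: (iffP eqP) => [->|]; first by exists [::], [::].
  by case=> [[|? ?]] [q] [].
case: eqP => [->|ne] /=; first by left; exists [::], (c :: w).
apply: (iffP (IH _)) => [[p [q [-> <-]]]|]; first by exists (c :: p), q.
case=> [[|c' p]] [q] [] //=; case=> -> ->; by exists p, q.
Qed.

End Run.

(** * Realizing [G] in the transition monoid of the minimal automaton *)

Section SyntacticGroup.
Variables (T : finType) (A : finType) (g : A -> {perm T}).
Variables (G : {group {perm T}}) (o : T) (X : seq (seq A)).
Variables (F : seq A -> Prop) (V : seq A) (u : A -> seq A).
Local Notation run := (run g).
Local Notation L := (star X).
Hypothesis genG : (G : {set {perm T}}) = <<[set g c | c : A]>>%g.
Hypothesis X_return : forall x, x \in X -> run o x = o.
Hypothesis X_first_return :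
  forall a b, a ++ b \in X -> run o a = o -> a = [::] \/ b = [::].
Hypothesis F_infix : forall w w', infix w w' -> F w' -> F w.
Hypothesis F_return : forall w, F w -> run o w = o -> L w.
Hypothesis V_hits : forall t, hits g o t V.
Hypothesis F_V : forall m c, F (power V m ++ u c ++ power V m).
Hypothesis F_V0 : forall m, F (power V m).
Hypothesis run_u : forall t c, run t (u c) = g c t.

Lemma star_nil : L [::].
Proof. by exists [::]. Qed.

Lemma star_cat a b : L a -> L b -> L (a ++ b).
Proof.
move=> [s [Xs <-]] [s' [Xs' <-]]; exists (s ++ s').
by rewrite all_cat Xs Xs' flatten_cat.
Qed.

Lemma star_return w : L w -> run o w = o.
Proof.
move=> [s [Xs <-]]; elim: s Xs => //= x s IH /andP[/X_return Xx Xs].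
by rewrite run_cat Xx IH.
Qed.

(** No code word visits [o] strictly inside, so every visit of [o] along a word of [L] falls on a
    boundary of its factorization. *)
Lemma star_split a b : L (a ++ b) -> run o a = o -> L a /\ L b.
Proof.
move=> [s [+ E]]; elim: s a E => [|x s IH] a.
  by case: a => //= <- _ _; split; apply: star_nil.
move=> /= E /andP[Xx Xs] ra.
have Lx : L x by exists [:: x]; rewrite /= Xx cats0.
case: (leqP (size x) (size a)) => le.
  have Ea : a = x ++ drop (size x) a.
    have := congr1 (take (size x)) E; rewrite take_size_cat // takel_cat // => Ex.
    by rewrite {1}Ex cat_take_drop.
  move: E ra; rewrite Ea -catA run_cat X_return // => /eqP; rewrite eqseq_cat //.
  case/andP=> _ /eqP E ra; have [La Lb] := IH _ E Xs ra.
  by split=> //; apply: star_cat.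
have Ex : x = a ++ drop (size a) x.
  have := congr1 (take (size a)) E; rewrite takel_cat 1?ltnW // take_size_cat //.
  by move=> Ea; rewrite -{1}Ea cat_take_drop.
rewrite Ex in Xx; case: (X_first_return Xx ra) => [a0|d0].
  rewrite a0; split; first exact: star_nil.
  by move: E; rewrite a0 /= => <-; apply: star_cat => //; exists s.
by move: le; rewrite Ex d0 cats0 ltnn.
Qed.

Lemma V_split t : {p : seq A * seq A | V = p.1 ++ p.2 /\ run t p.1 = o}.
Proof.
apply: constructive_indefinite_description.
by have /hitsP[p [q H]] := V_hits t; exists (p, q).
Qed.

Definition Vperm := wperm g V.

(* Reading [V] passes through [o], where a word of [X^*] is cut; so the state
   reached by [w ++ V] only depends on the suffix of [V] after that visit of [o],
   and one such suffix is chosen for each end point [s]. *)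
Definition tail s := (sval (V_split ((Vperm^-1)%g s))).2.

Lemma tailP s :
  exists p, [/\ V = p ++ tail s, run ((Vperm^-1)%g s) p = o & run o (tail s) = s].
Proof.
rewrite /tail; case: V_split => [[p q] [/= E rp]]; exists p; split=> //.
by rewrite -rp -run_cat -E runE permKV.
Qed.

Lemma F_tail s m c : F (tail s ++ u c ++ power V m).
Proof.
have [p [E _ _]] := tailP s.
apply: F_infix (F_V m.+1 c); apply/infixP; exists (power V m ++ p), V.
by rewrite !powerSr {2}E -!catA.
Qed.

Lemma F_tail0 s m : F (tail s ++ power V m).
Proof.
have [p [E _ _]] := tailP s.
apply: F_infix (F_V0 m.+1); apply/infixP; exists p, [::].
by rewrite powerS {1}E -!catA cats0.
Qed.

(** From any point [V] visits [o]; stopping there gives a word of [F] that fixes [o], hence a word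
    of [L]. *)
Lemma completion w : F (w ++ V) -> nonempty_lang (resid L w).
Proof.
move=> Fw; have /hitsP[p [q [E rp]]] := V_hits (run o w).
exists p; apply: F_return; last by rewrite run_cat.
by apply: F_infix Fw; apply/infixP; exists [::], q; rewrite E -!catA.
Qed.

Lemma beta_state s : is_state L (resid L (tail s)).
Proof.
by split; [exists (tail s)|apply: completion; rewrite -(power1 V); apply: F_tail0].
Qed.

Definition beta s : state L := exist _ _ (beta_state s).

Lemma resid_V w :
  nonempty_lang (resid L (w ++ V)) -> resid L (w ++ V) = resid L (tail (run o (w ++ V))).
Proof.
move=> [y Ly]; have [p [E rp rt]] := tailP (run o (w ++ V)).
(* [p] was chosen to start at the preimage under [Vperm] of the end point, which is [run o w]. *)
have rwp : run o (w ++ p) = o.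
  by rewrite run_cat -[RHS]rp; congr run; rewrite run_cat [run _ V]runE permK.
have EV z : (w ++ V) ++ z = (w ++ p) ++ (tail (run o (w ++ V)) ++ z).
  by rewrite {1}E -!catA.
move: Ly; rewrite {1}/resid EV => /star_split-/(_ rwp)[Lwp _].
apply: lang_ext => z; rewrite /resid EV; split; last exact: star_cat.
by move=> /star_split-/(_ rwp)[].
Qed.

(** Words act injectively on points, so one word accepted from [beta s] determines [s]. This
    separates the states [beta s] and identifies the action on them. *)
Lemma beta_ctx s y : sval (beta s) y -> run s y = o.
Proof.
have [_ [_ _ rt]] := tailP s.
by move=> /star_return; rewrite run_cat rt.
Qed.

Lemma beta_inj : injective beta.
Proof.
move=> s s' E; have [y Ly] := (beta_state s).2.
apply: (@run_inj _ _ g y); rewrite [LHS](@beta_ctx s) //.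
by rewrite [RHS](@beta_ctx s') // -E.
Qed.

Lemma act_V_image w q q' : act (w ++ V) q = Some q' -> exists s, q' = beta s.
Proof.
move=> /actP; have [[x Ex] _] := proj2_sig q; rewrite Ex -resid_cat catA => E.
exists (run o ((x ++ w) ++ V)); apply: state_eq; rewrite E /=.
by apply: resid_V; rewrite -E; case: (proj2_sig q').
Qed.

(** The last [V] in the hypothesis is the room for a completion in [L], which makes the transition
    defined. *)
Lemma act_beta s w : F (tail s ++ (w ++ V) ++ V) ->
  act (w ++ V) (beta s) = Some (beta (run s (w ++ V))).
Proof.
move=> Fw; have [_ [_ _ rt]] := tailP s.
apply/actP; rewrite /= -resid_cat catA -{1}rt -run_cat catA; symmetry.
by apply: resid_V; apply: completion; rewrite -!catA in Fw *.
Qed.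

Lemma act_beta_run s w s' : act w (beta s) = Some (beta s') -> s' = run s w.
Proof.
move=> /actP E; have [y Ly] := (beta_state s').2.
apply: (@run_inj _ _ g y); rewrite (@beta_ctx s') // -run_cat (@beta_ctx s) //.
by have : sval (beta s') y by []; rewrite E.
Qed.

Local Notation N := #|[set: {perm T}]|.
Definition idem_word := power V N.
Definition idem : state L -> option (state L) := act idem_word.

Lemma idem_wordE : idem_word = power V N.-1 ++ V.
Proof. by rewrite -powerSr prednK // cardG_gt0. Qed.

Lemma run_idem_word t : run t idem_word = t.
Proof. by have := run_power_card g V 1 t; rewrite muln1. Qed.

Lemma idem_beta s : idem (beta s) = Some (beta s).
Proof.
rewrite /idem idem_wordE act_beta -?idem_wordE ?run_idem_word //.
by rewrite /idem_word -powerSr; apply: F_tail0.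
Qed.

Lemma idem_image q q' : idem q = Some q' -> exists s, q' = beta s.
Proof. rewrite /idem idem_wordE; exact: act_V_image. Qed.

Lemma act_letter_beta c s : act (u c ++ idem_word) (beta s) = Some (beta (g c s)).
Proof.
have uE : u c ++ idem_word = (u c ++ power V N.-1) ++ V by rewrite -catA -idem_wordE.
rewrite uE act_beta -uE; first by rewrite run_cat run_idem_word run_u.
by rewrite -catA /idem_word -powerSr; apply: F_tail.
Qed.

Definition beta_lift (h : {perm T}) (q : state L) : option (state L) :=
  match excluded_middle_informative (exists s, q = beta s) with
  | left H => Some (beta (h (sval (constructive_indefinite_description _ H))))
  | right _ => None
  end.

Lemma beta_lift_beta h s : beta_lift h (beta s) = Some (beta (h s)).
Proof.
rewrite /beta_lift; case: excluded_middle_informative => [H|[]]; last by exists s.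
by case: constructive_indefinite_description => s' /= /beta_inj ->.
Qed.

(** Precomposing with [idem] extends the permutation [h] of its image to a partial map on all
    states. *)
Definition sigma h := pcomp idem (beta_lift h).

Lemma sigmaE h q s : idem q = Some (beta s) -> sigma h q = Some (beta (h s)).
Proof. by rewrite /sigma /pcomp => -> /=; rewrite beta_lift_beta. Qed.

Lemma sigma_beta h s : sigma h (beta s) = Some (beta (h s)).
Proof. exact/sigmaE/idem_beta. Qed.

Lemma sigmaN h q : idem q = None -> sigma h q = None.
Proof. by rewrite /sigma /pcomp => ->. Qed.

Lemma sigma_ext f (h : {perm T}) : (forall q, idem q = None -> f q = None) ->
  (forall q s, idem q = Some (beta s) -> f q = Some (beta (h s))) -> f = sigma h.
Proof.
move=> fN fS; apply: functional_extensionality => q.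
case Eq: (idem q) => [q'|]; last by rewrite fN // sigmaN.
by have [s Es] := idem_image Eq; rewrite Es in Eq; rewrite (fS _ _ Eq) (sigmaE _ Eq).
Qed.

Lemma sigma1 : sigma 1%g = idem.
Proof. by symmetry; apply: sigma_ext => // q s ->; rewrite perm1. Qed.

Lemma sigmaM h h' : sigma (h * h')%g = pcomp (sigma h) (sigma h').
Proof.
symmetry; apply: sigma_ext => q; first by rewrite /pcomp => /sigmaN ->.
by move=> s Es; rewrite /pcomp (sigmaE _ Es) /= sigma_beta permM.
Qed.

Lemma pcomp_idem_sigma h : pcomp idem (sigma h) = sigma h.
Proof. by rewrite -sigma1 -sigmaM mul1g. Qed.

Lemma pcomp_sigma_idem h : pcomp (sigma h) idem = sigma h.
Proof. by rewrite -sigma1 -sigmaM mulg1. Qed.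

Lemma sigma_inj : injective sigma.
Proof.
move=> h h' Eq; apply/permP => s; apply: beta_inj.
by apply: Some_inj; rewrite -!sigma_beta Eq.
Qed.

Lemma sigma_letter c : sigma (g c) = act (idem_word ++ u c ++ idem_word).
Proof.
symmetry; rewrite act_cat; apply: sigma_ext => q; first by rewrite /pcomp -/idem => ->.
by move=> s Es; rewrite /pcomp -/idem Es /= act_letter_beta.
Qed.

Local Notation M := (@trans_monoid A L).

Lemma trans_monoid_comp f h : M f -> M h -> M (pcomp f h).
Proof. by move=> [w ->] [w' ->]; exists (w ++ w'); rewrite act_cat. Qed.

(** The [h] with [sigma h] in [M] contain 1 and the generators and are closed under products, hence
    form a subgroup by finiteness. *)
Lemma sigma_trans h : h \in G -> M (sigma h).
Proof.
pose K := [set h | if excluded_middle_informative (M (sigma h)) then true else false].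
have KP h' : reflect (M (sigma h')) (h' \in K).
  by rewrite inE; case: excluded_middle_informative => ?; constructor.
have gK : group_set K.
  apply/group_setP; split; first by apply/KP; rewrite sigma1; exists idem_word.
  move=> h1 h2 /KP K1 /KP K2; apply/KP; rewrite sigmaM; exact: trans_monoid_comp.
move=> hG; apply/KP; move: hG; rewrite genG; apply: subsetP.
rewrite (gen_subG _ (Group gK)); apply/subsetP => _ /imsetP[c _ ->].
by apply/KP; exists (idem_word ++ u c ++ idem_word); rewrite sigma_letter.
Qed.

Lemma sigma_unit h : h \in G -> unit_group M idem (sigma h).
Proof.
move=> hG; split; [exact: sigma_trans|exact: pcomp_idem_sigma|exact: pcomp_sigma_idem|].
exists (sigma h^-1%g); split; rewrite ?pcomp_idem_sigma ?pcomp_sigma_idem //.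
- by apply: sigma_trans; rewrite groupV.
- by rewrite -sigmaM mulgV sigma1.
- by rewrite -sigmaM mulVg sigma1.
Qed.

(** A unit is the action of a word [w]. Its inverse forces it to be defined on the image of [idem],
    where it can only act as [wperm g w], a product of generators. *)
Lemma unit_sigma f : unit_group M idem f -> exists2 h, h \in G & sigma h = f.
Proof.
move=> [[w fw] lf rf [f' [_ _ _ ff' _]]].
exists (wperm g w).
  by apply: wperm_in => c; rewrite genG mem_gen // imset_f.
symmetry; apply: sigma_ext => q; first by rewrite -lf /pcomp => ->.
move=> s Es; rewrite -lf /pcomp Es /=.
have := congr1 (fun k => k (beta s)) ff'; rewrite /pcomp idem_beta.
case Ef: (f (beta s)) => [q'|] //= _.
have [s' Es'] : exists s', q' = beta s'.
  by have := congr1 (fun k => k (beta s)) rf; rewrite /pcomp Ef /= => /idem_image.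
rewrite Es'; congr (Some (beta _)).
by rewrite -runE; apply: act_beta_run; rewrite -fw -Es'.
Qed.

Theorem cover_is_syntactic_group : is_syntactic_group G X.
Proof.
exists (unit_group M idem); split.
  apply: unit_group_maximal; [exact: trans_monoid_comp|by exists idem_word|].
  by rewrite -sigma1 -sigmaM mul1g.
exists beta, sigma; split; first exact: beta_inj.
split; [|split; first exact: sigma_unit].
  move=> s; split=> [/(_ idem)[]|[t <-] f /unit_sigma[h hG <-]].
  - by have := sigma_unit (group1 G); rewrite sigma1.
  - by move=> q /idem_image[t ->]; exists t.
  - by exists (beta (h^-1%g t)); rewrite sigma_beta permKV.
split; first by move=> h h' _ _; apply: sigma_inj.
split; first exact: unit_sigma.
split; first by move=> h h' _ _; apply: sigmaM.
by move=> t h _; apply: sigma_beta.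
Qed.

End SyntacticGroup.

(** * Factors of powers and of concatenations *)

Section Infix.
Variable A : eqType.
Implicit Types (w x y z : seq A).

Lemma infix_mid x w y : infix w (x ++ w ++ y).
Proof. by apply/infixP; exists x, y. Qed.

Lemma prefix_cat2l x y z : prefix (x ++ y) (x ++ z) = prefix y z.
Proof. by rewrite prefix_catr // eqxx. Qed.

(** An occurrence starts inside some block [v]; dropping the rest of that block leaves enough
    letters for [m] whole blocks. *)
Lemma infix_power v m n w :
  infix w (power v n) -> m.+1 * size v <= size w -> infix (power v m) w.
Proof.
elim: n => [|n IH].
  rewrite infixs0 => /eqP ->; rewrite leqn0 muln_eq0 => /eqP/size0nil ->.
  by elim: m.
case/infixP=> [x [y]]; rewrite powerS => E le.
case: (leqP (size v) (size x)) => lx.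
  apply: IH => //; have := congr1 (drop (size v)) E.
  rewrite drop_size_cat // drop_cat; case: ltngtP lx => // [_|->] _ ->.
    exact: infix_mid.
  by rewrite subnn drop0; apply: (infix_mid [::]).
have Ew : w = drop (size x) v ++ drop (size v - size x) w.
  have := congr1 (drop (size x)) E; rewrite drop_cat lx drop_size_cat // => E1.
  have := congr1 (take (size v - size x)) E1.
  rewrite take_size_cat ?size_drop // takel_cat; last by lia.
  by move=> E2; rewrite E2 cat_take_drop.
set r := drop _ w in Ew.
have szr : m * size v <= size r by rewrite size_drop; lia.
have Er : power v n = r ++ y.
  have := congr1 (drop (size x)) E; rewrite drop_cat lx drop_size_cat // Ew -catA.
  by move/eqP; rewrite eqseq_cat // => /andP[_ /eqP].
have mn : m <= n \/ size v = 0.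
  have := congr1 size Er; rewrite size_power size_cat => E2.
  case: (size v) szr E2 => [|s] H1 H2; [by right|left].
  by rewrite -(leq_pmul2r (ltn0Sn s)); lia.
have /prefixP[z Ez] : prefix (power v m) r.
  case: mn => [mn|/size0nil v0]; last first.
    by rewrite (_ : power v m = [::]) ?prefix0s // v0; elim: (m).
  move: Er; rewrite -(subnKC mn) powerD => Er.
  have := congr1 (take (size r)) Er; rewrite [RHS]take_size_cat // take_cat size_power.
  by case: ltngtP szr => // [_|->] _ <-; rewrite ?subnn ?take0 ?cats0 ?prefix_refl ?prefix_prefix.
by rewrite Ew Ez infix_mid.
Qed.

Lemma infix_cat_cases w x y : infix w (x ++ y) ->
  exists w1 w2, [/\ w = w1 ++ w2, infix w1 x & infix w2 y].
Proof.
case/infixP=> [p [s E]].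
case: (leqP (size x) (size p)) => l1.
  exists [::], w; split=> //; first exact: infix0s.
  have := congr1 (drop (size x)) E; rewrite drop_size_cat // drop_cat.
  case: ltngtP l1 => // [_|->] _ ->; first exact: infix_mid.
  by rewrite subnn drop0; apply: (infix_mid [::]).
have E1 : drop (size p) x ++ y = w ++ s.
  by have := congr1 (drop (size p)) E; rewrite drop_cat l1 drop_size_cat.
have xd : infix (drop (size p) x) x.
  by rewrite -{2}(cat_take_drop (size p) x) suffix_infix.
case: (leqP (size w) (size (drop (size p) x))) => l2.
  exists w, [::]; rewrite cats0 infix0s; split=> //.
  apply: infix_trans xd.
  have := congr1 (take (size w)) E1; rewrite takel_cat // take_size_cat // => <-.
  exact: infix_take.
exists (drop (size p) x), (drop (size (drop (size p) x)) w).
have Ew : w = drop (size p) x ++ drop (size (drop (size p) x)) w.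
  have := congr1 (take (size (drop (size p) x))) E1.
  rewrite take_size_cat // takel_cat 1?ltnW // => E2.
  by rewrite {1}E2 cat_take_drop.
split=> //.
have := congr1 (drop (size (drop (size p) x))) E1.
by rewrite drop_size_cat // drop_cat l2 => ->; apply: (infix_mid [::]).
Qed.

End Infix.

(** * Episturmian morphisms and left special factors *)

Section Episturmian.
Variable A : finType.
Implicit Types (i j c : A) (w x y z : seq A) (l : seq A).

Definition rho i w : seq A := flatten [seq if c == i then [:: i] else [:: i; c] | c <- w].

Definition subst l w := foldr rho w l.

Lemma rho_cons i c w : rho i (c :: w) = (if c == i then [:: i] else [:: i; c]) ++ rho i w.
Proof. by []. Qed.

Lemma rho_cat i w w' : rho i (w ++ w') = rho i w ++ rho i w'.
Proof. by rewrite /rho map_cat flatten_cat. Qed.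

Lemma subst_cat l w w' : subst l (w ++ w') = subst l w ++ subst l w'.
Proof. by elim: l => //= i l ->; rewrite rho_cat. Qed.

Lemma subst_cons l c w : subst l (c :: w) = subst l [:: c] ++ subst l w.
Proof. exact: (subst_cat l [:: c]). Qed.

Lemma subst_comp l l' w : subst (l ++ l') w = subst l (subst l' w).
Proof. by rewrite /subst foldr_cat. Qed.

Lemma subst_nseq l i n : subst l (nseq n i) = power (subst l [:: i]) n.
Proof.
elim: n => [|n IH]; last by rewrite powerS -IH -subst_cat.
by elim: l => //= j l ->.
Qed.

(** [rho i] keeps the last letter of a word. Hence the image of [c] puts [c] itself in front of
    whatever follows. *)
Lemma subst_last l c : exists w, subst l [:: c] = rcons w c.
Proof.
elim: l => [|i l [w /= ->]]; first by exists [::].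
rewrite -cats1 rho_cat /rho /=; case: eqP => [->|_].
  by exists (rho i w); rewrite cats1.
by exists (rho i w ++ [:: i]); rewrite -cats1 -catA.
Qed.

Lemma subst_nseq_letter i j n :
  subst (nseq n i) [:: j] = if j == i then [:: i] else rcons (nseq n i) j.
Proof.
elim: n => [|n IH] /=; first by case: eqP => [->|].
rewrite IH; case: eqP => [_|/eqP/negbTE ne]; first by rewrite /rho /= eqxx.
have rn : rho i (nseq n i) = nseq n i.
  by elim: (n) => //= m IHm; rewrite rho_cons eqxx IHm.
rewrite -cats1 rho_cat rn rho_cons ne /= -[[:: i; j]]/([:: i] ++ [:: j]) catA cats1.
by rewrite -[[:: i]]/(nseq 1 i) -nseqD addn1 /= ?cats1.
Qed.

(* With [v = subst l [:: i]], these are the factors of the bi-infinite words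
   ...vvv subst(j) vvv..., and the prefixes of the right-infinite word vvv... *)
Definition factor l i w := exists m j, infix w (subst l (nseq m i ++ j :: nseq m i)).

Definition pref l i w := exists m, prefix w (subst l (nseq m i)).

(** Desubstitution: either [c] closes a block and [y] reads the following blocks, or [c] is the [i]
    opening a block of two letters. *)
Lemma infix_rho_cons i c y w : infix (c :: y) (rho i w) ->
  (exists z, infix (c :: z) w /\ prefix y (rho i z)) \/
  (c = i /\ (y = [::] \/ exists d y', y = d :: y' /\ d != i)).
Proof.
elim: w => [|d w IH]; first by rewrite infixs0.
have lft z : infix (c :: z) w -> infix (c :: z) (d :: w).
  by move=> H; rewrite /= H orbT.
have IH' : infix (c :: y) (rho i w) ->
  (exists z, infix (c :: z) (d :: w) /\ prefix y (rho i z)) \/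
  (c = i /\ (y = [::] \/ exists d y', y = d :: y' /\ d != i)).
  by move=> /IH [[z [H1 H2]]|H]; [left; exists z; split=> //; apply: lft|right].
rewrite rho_cons; case: eqP => [di|/eqP ne].
  rewrite /= => /orP[/andP[/eqP -> py]|]; last exact: IH'.
  by left; exists w; rewrite /= di eqxx prefix_refl.
rewrite /= => /or3P[/andP[/eqP -> py]|/andP[/eqP -> py]|].
- right; split=> //.
  case: y py {IH IH' lft} => [|d' y]; first by left.
  by case/andP=> /eqP -> _; right; exists d, y.
- by left; exists w; rewrite /= eqxx prefix_refl.
- exact: IH'.
Qed.

(** Where [z] and [z'] first differ, the images share at most one more [i]: the block of [i] is
    followed by another [i], and any other block has its own letter in second place. *)
Lemma common_prefix_rho i z z' y : prefix y (rho i z) -> prefix y (rho i z') ->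
  exists x, [/\ prefix x z, prefix x z' & prefix y (rcons (rho i x) i)].
Proof.
have nilx z1 z2 y1 : prefix y1 [:: i] ->
    exists x, [/\ prefix x z1, prefix x z2 & prefix y1 (rcons (rho i x) i)].
  by exists [::]; rewrite !prefix0s.
elim: z z' y => [|d z IH] z' y.
  by rewrite prefixs0 => /eqP -> _; apply: nilx.
case: z' => [|d' z'].
  by move=> _; rewrite prefixs0 => /eqP ->; apply: nilx.
case: (eqVneq d d') => [<-|ne]; rewrite !rho_cons.
  set b := (if _ then _ else _) => p p'.
  case: (leqP (size b) (size y)) => le.
    have Ey : y = b ++ drop (size b) y.
      case/prefixP: p => s Es; have := congr1 (take (size b)) Es.
      rewrite [RHS]takel_cat // [LHS]take_size_cat // => E; by rewrite {1}E cat_take_drop.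
    move: p p'; rewrite Ey !prefix_cat2l // => p p'.
    have [x [x1 x2 x3]] := IH _ _ p p'.
    exists (d :: x); rewrite !prefix_cons eqxx x1 x2; split=> //.
    by rewrite rho_cons -/b rcons_cat prefix_cat2l.
  have yb : prefix y b.
    case/prefixP: p => s Es; have := congr1 (take (size y)) Es.
    by rewrite [LHS]takel_cat 1?ltnW // [RHS]take_size_cat // => <-; apply: prefix_take.
  exists [:: d]; rewrite !prefix_cons eqxx !prefix0s; split=> //.
  apply: prefix_trans yb _; rewrite rho_cons -/b -cats1 -catA.
  exact: prefix_prefix.
move=> p p'; apply: nilx; move: p p'.
case: y => [|a [|a' y]]; rewrite ?prefix0s //.
  by case: eqP => _ /= /andP[/eqP -> _] _; rewrite eqxx.
have hd x : rho i x = [::] \/ exists x', rho i x = i :: x'.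
  case: x => [|b x]; [by left|right]; rewrite rho_cons.
  by case: eqP => _; eexists.
move=> p p'; exfalso; move: p p'.
case: eqP => [di|di]; case: eqP => [d'i|d'i] /=.
- by move: ne; rewrite di d'i eqxx.
- move=> /andP[_ p] /andP[_ /andP[/eqP E _]]; move: p; rewrite E.
  case: (hd z) => [->|[x' ->]]; rewrite ?prefix_cons //.
  by case/andP=> /eqP.
- move=> /andP[_ /andP[/eqP E _]] /andP[_ p]; move: p; rewrite E.
  case: (hd z') => [->|[x' ->]]; rewrite ?prefix_cons //.
  by case/andP=> /eqP.
- move=> /andP[_ /andP[/eqP E _]] /andP[_ /andP[/eqP E' _]].
  by move: ne; rewrite -E -E' eqxx.
Qed.

Lemma factor_infix l i w w' : infix w w' -> factor l i w' -> factor l i w.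
Proof. by move=> ww' [m [j H]]; exists m, j; apply: infix_trans H. Qed.

(* [rho i] maps the left special words, which form a chain for the prefix order,
   to words whose prefixes are exactly the left special words of the image. *)
Lemma factor_special l i c c' y :
  factor l i (c :: y) -> factor l i (c' :: y) -> c != c' -> pref l i y.
Proof.
elim: l c c' y => [|e l IH] c c' y.
  (* One of two distinct letters is not [i]; in [i...iji...i] only [i]s follow it. *)
  wlog ci : c c' / c != i.
    move=> H f f' ne; case: (eqVneq c i) => [ci|ci]; last exact: (H c c').
    by apply: (H c' c) => //; [rewrite -ci eq_sym|rewrite eq_sym].
  move=> [m [j]] + _ _ /=; elim: {1}m => [|n IHn] /=.
    case/orP=> [/andP[_ H]|]; first by exists m.
    move=> /mem_infix/(_ c); rewrite inE eqxx => /(_ isT) /nseqP[E].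
    by rewrite E eqxx in ci.
  by rewrite (negbTE ci).
wlog ce : c c' / c != e.
  move=> H f f' ne; case: (eqVneq c e) => [ci|ci]; last exact: (H c c').
  by apply: (H c' c) => //; [rewrite -ci eq_sym|rewrite eq_sym].
case=> [m [j /= /infix_rho_cons]] [[z [iz pz]]|[E _]]; last by rewrite E eqxx in ce.
case=> [m' [j' /= /infix_rho_cons]] [[z' [iz' pz']]|]; last first.
  (* After an inserted [e], a nonempty [y] starts with a letter other than [e]; but [y] is also a
     prefix of an image, which starts with [e]. *)
  case=> _ [->|[d [y' [Ey de]]]]; first by exists 0; rewrite prefix0s.
  case: z pz {iz} => [|b z]; rewrite Ey ?rho_cons //.
  by case: eqP => _; rewrite prefix_cons (negbTE de).
move=> ne; have [x [xz xz' yx]] := common_prefix_rho pz pz'.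
have cx (a : A) z0 : prefix x z0 -> infix (a :: x) (a :: z0).
  by move=> p; apply: prefixW; rewrite prefix_cons eqxx.
have [n px] : pref l i x.
  apply: (IH c c') => //; [exists m, j|exists m', j'].
    exact: infix_trans (cx _ _ xz) iz.
  exact: infix_trans (cx _ _ xz') iz'.
(* One more [i] guarantees a letter after [x], whose block opens with the extra [e]. *)
exists n.+1; apply: prefix_trans yx _; rewrite -[subst _ _]/(rho e (subst l _)).
have [w Ew] := subst_last l i.
case/prefixP: px => s Es.
rewrite -addn1 nseqD subst_cat Es Ew -catA rho_cat -cats1 prefix_cat2l //.
have : s ++ rcons w i != [::] by rewrite -size_eq0 size_cat size_rcons addnS.
by case: (s ++ _) => // b r _; rewrite rho_cons; case: eqP => _; rewrite prefix_cons eqxx prefix0s.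
Qed.

Lemma pref_factor l i c y : pref l i y -> factor l i (c :: y).
Proof.
case=> m py; exists m, c; rewrite subst_cat subst_cons.
have [w ->] := subst_last l c; rewrite -cats1 -catA catA.
case/prefixP: py => s Es; apply/infixP; exists (subst l (nseq m i) ++ w), s.
by rewrite {2}Es -!catA.
Qed.

Lemma subst_gt0 l i : 0 < size (subst l [:: i]).
Proof. by have [w ->] := subst_last l i; rewrite size_rcons. Qed.

(** One more [v] on either side leaves a letter to the left of the occurrence. *)
Lemma factor_cons l i y : factor l i y -> exists c, factor l i (c :: y).
Proof.
case=> m [j /infixP[p [s E]]].
have E1 : subst l (i :: nseq m i ++ j :: nseq m.+1 i)
    = (subst l [:: i] ++ p) ++ y ++ (s ++ subst l [:: i]).
  by rewrite subst_cons -addn1 nseqD -cat_cons catA subst_cat E -!catA.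
have : 0 < size (subst l [:: i] ++ p) by rewrite size_cat ltn_addr // subst_gt0.
case/lastP: (subst l [:: i] ++ p) E1 => // q c E1 _.
exists c, m.+1, j; rewrite E1; apply/infixP; exists q, (s ++ subst l [:: i]).
by rewrite cat_rcons.
Qed.

Lemma factor_nil l i : factor l i [::].
Proof. by exists 0, i; rewrite infix0s. Qed.

Lemma factor_long l i m : exists B, forall y, factor l i y -> B <= size y ->
  infix (power (subst l [:: i]) m) y.
Proof.
set v := subst l [:: i].
(* The middle of a factor lies in a single [subst l [:: j]], so at this length one outer part has
   size at least [m.+1 * size v]. *)
exists (m.+1 * size v + (\max_(j : A) size (subst l [:: j])) + m.+1 * size v).
move=> y [n [j]]; rewrite subst_cat subst_cons subst_nseq -/v.
case/infix_cat_cases=> [y1 [y' [-> i1]]] /infix_cat_cases[y2 [y3 [-> i2 i3]]] le.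
have le2 : size y2 <= \max_(j : A) size (subst l [:: j]).
  by apply: leq_trans (size_infix i2) _; exact: (leq_bigmax j).
have [l1|l3] : m.+1 * size v <= size y1 \/ m.+1 * size v <= size y3.
  move: le le2; rewrite !size_cat; move: (_ * _) (\max_(j : A) _) => a b le le2.
  have [|l1] := leqP a (size y1); [by left|right].
  have [//|l3] := leqP a (size y3).
  by move: le le2 l1 l3; move: (size y1) (size y2) (size y3) => a1 a2 a3; lia.
  apply: infix_trans (infix_power i1 l1) _; exact: (infix_mid [::]).
apply: infix_trans (infix_power i3 l3) _; rewrite catA -[X in _ ++ X]cats0.
exact: infix_mid.
Qed.

End Episturmian.

(** * Choosing substitutions for which a power of [v] always visits [o] *)

Section Cover.
Variables (T A : finType) (g : A -> {perm T}) (G : {group {perm T}}) (o : T).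
Hypothesis genG : (G : {set {perm T}}) = <<[set g c | c : A]>>%g.
Hypothesis transG : [transitive G, on [set: T] | 'P].

Lemma hits_cat t w w' : hits g o t (w ++ w') = hits g o t w || hits g o (run g t w) w'.
Proof.
elim: w t => [|c w IH] t /=; last by rewrite IH orbA.
by rewrite orbF; case: w' => [|c w'] /=; rewrite ?orbA orbb ?orbF.
Qed.

Lemma hits_base w : hits g o o w.
Proof. by case: w => [|c w] /=; rewrite eqxx. Qed.

(** Otherwise [B] would be stable under the generators, hence under [G], and would contain the orbit
    of [t], which includes [o]. *)
Lemma transitive_exit (B : {set T}) : o \notin B -> B != set0 ->
  exists t c, t \in B /\ g c t \notin B.
Proof.
move=> oB /set0Pn[t tB].
suff /existsP[s /existsP[c /andP[sB cB]]] :
  [exists s, exists c, (s \in B) && (g c s \notin B)] by exists s, c.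
apply: contraR oB => /existsPn no.
have GB : G \subset 'N(B | 'P)%g.
  rewrite genG gen_subG; apply/subsetP => _ /imsetP[c _ ->].
  rewrite !inE /=; apply/subsetP => s sB; rewrite inE /=.
  by have /existsPn/(_ c) := no s; rewrite sB /= negbK.
have /orbitP[h hG <-] : o \in orbit 'P G t.
  by rewrite (atransP transG) ?inE.
by rewrite (astabs_act _ (subsetP GB _ hG)).
Qed.

(* Each round adjoins [N * m] substitutions [rho i], [N] being a multiple of
   every order: the words [subst l [:: j]] still induce [g j], but those with
   [j <> i] now start with [power v m] for the previous [v = subst l [:: i]]. So
   the points that reach [o] along [v] still do, and so do their [g c]-preimages. *)
Lemma exists_cover (i0 : A) : exists l i m,
  (forall t c, run g t (subst l [:: c]) = g c t) /\
  (forall t, hits g o t (power (subst l [:: i]) m)).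
Proof.
suff H n l i m : (forall t c, run g t (subst l [:: c]) = g c t) ->
    #|[set t | ~~ hits g o t (power (subst l [:: i]) m)]| <= n ->
    exists l i m, (forall t c, run g t (subst l [:: c]) = g c t) /\
      (forall t, hits g o t (power (subst l [:: i]) m)).
  exact: (H _ [::] i0 0 _ (leqnn _)).
elim: n l i m => [|n IH] l i m run_l.
  rewrite leqn0 cards_eq0 => /eqP B0; exists l, i, m; split=> // t.
  by apply: contraT => nh; have := in_set0 t; rewrite -B0 inE nh.
set B := [set t | _] => leB.
have [B0|Bn0] := eqVneq B set0; first by apply: (IH l i m) => //; rewrite -/B B0 cards0.
have oB : o \notin B by rewrite inE hits_base.
have [t [c [tB cB]]] := transitive_exit oB Bn0.
pose N := #|[set: {perm T}]|; pose l' := l ++ nseq (N * m) i.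
have substl' j : subst l' [:: j] =
    if j == i then subst l [:: i] else power (subst l [:: i]) (N * m) ++ subst l [:: j].
  rewrite subst_comp subst_nseq_letter; case: eqP => // _.
  by rewrite -cats1 subst_cat subst_nseq.
have run_l' s j : run g s (subst l' [:: j]) = g j s.
  rewrite substl'; case: eqP => [->|_] //.
  by rewrite run_cat run_power_card.
(* [m.+1] copies begin with the old [power v m], also when [c = i]; one more copy in front first
   moves [t] to [g c t]. *)
apply: (IH l' c m.+2) => //; rewrite -ltnS; apply: leq_trans leB.
have [r Er] : exists r, power (subst l' [:: c]) m.+1 = power (subst l [:: i]) m ++ r.
  rewrite substl'; case: eqP => _; first by exists (subst l [:: i]); rewrite powerSr.
  have -> : N * m = m + N.-1 * m by rewrite -mulSn prednK // cardG_gt0.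
  by rewrite powerS powerD -!catA; eexists.
apply: proper_card; apply/properP; split.
  apply/subsetP => s; rewrite !inE; apply: contra => hs.
  by rewrite powerSr hits_cat Er hits_cat hs.
exists t => //; rewrite !inE negbK powerS hits_cat run_l' Er hits_cat.
by move: cB; rewrite inE negbK => ->; rewrite orbT.
Qed.

End Cover.

Section Words.
Variable A : finType.

Fixpoint words n : seq (seq A) :=
  if n is n'.+1 then [::] :: [seq c :: w | c <- enum A, w <- words n'] else [::].

Lemma mem_words n w : (w \in words n) = (size w < n).
Proof.
elim: n w => [|n IH] [|c w] //=; rewrite inE /= ltnS -IH.
apply/allpairsP/idP => [[[c' w'] /= [_ H [_ ->]]] //|H].
by exists (c, w); rewrite mem_enum.
Qed.

Lemma words_uniq n : uniq (words n).
Proof.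
elim: n => //= n IH; apply/andP; split; first by apply/allpairsP => -[[]] ? ? [].
by apply: allpairs_uniq => //; [exact: enum_uniq|move=> [? ?] [? ?] _ _ [-> ->]].
Qed.

End Words.

Definition decide (P : Prop) : bool :=
  if excluded_middle_informative P then true else false.

Lemma decideP (P : Prop) : reflect P (decide P).
Proof. by rewrite /decide; case: excluded_middle_informative => ?; constructor. Qed.

(** * The finite bifix code of first returns and its cardinality *)

Section ReturnCode.
Variables (T A : finType) (g : A -> {perm T}) (o : T) (l : seq A) (i : A) (m : nat).
Local Notation run := (run g).
Local Notation F := (factor l i).
Hypothesis cover : forall t, hits g o t (power (subst l [:: i]) m).

(* Nodes of the tree of suffixes of the code: [y] is read backwards from [o], and
   stops at its first return to [o]. *)
Definition node y :=
  F y /\ forall a b, y = a ++ b -> a <> [::] -> b <> [::] -> run o b <> o.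

(** A long factor contains [power v m] strictly inside and so visits [o] there, whatever its
    starting point; if the whole word ends at [o], what remains is a proper suffix fixing [o]. *)
Lemma node_bound : exists B, forall y, node y -> size y < B.
Proof.
(* The 2 accounts for the first and last letters, set aside to make the visit strictly interior. *)
have [B HB] := factor_long l i m; exists B.+2 => y [Fy ny].
rewrite ltnNge; apply/negP => le.
case: y => [//|c y] in Fy ny le *; case/lastP: y => [//|y c'] in Fy ny le *.
have Fy' : F y.
  apply: factor_infix Fy; apply/infixP; exists [:: c], [:: c'].
  by rewrite /= cats1.
have /infixP[p [s Ey]] : infix (power (subst l [:: i]) m) y.
  by apply: HB => //; move: le; rewrite /= size_rcons.
pose t := (wperm g (c :: rcons y c'))^-1%g o.
have rt : run t (c :: rcons y c') = o by rewrite runE permKV.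
have /hitsP[a [b [Eab ra]]] := cover (run t (c :: p)).
have Ew : c :: rcons y c' = (c :: p ++ a) ++ (b ++ rcons s c').
  by rewrite -cats1 Ey Eab -cats1 /= -!catA.
case: (ny _ _ Ew) => //; first by case: (b) => [|//]; case: (s).
rewrite -[RHS]rt Ew [RHS]run_cat; congr run.
by rewrite -cat_cons run_cat ra.
Qed.

Definition return_word y := (y != [::]) && (run o y == o).

Lemma node_cons c y : node (c :: y) <-> [/\ node y, ~~ return_word y & F (c :: y)].
Proof.
split=> [[Fy ny]|[[Fy ny] /nandP ry Fcy]].
  split=> //; first split.
  - by apply: factor_infix Fy; rewrite /= infix_refl orbT.
  - by move=> a b Ey a0 b0; apply: (ny (c :: a)); rewrite // Ey.
  - by apply/andP => -[/eqP y0 /eqP]; apply: (ny [:: c]).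
split=> // -[//|c' a] b [_ Ey] _ b0 rb.
case: a Ey => [|c'' a] Ey; last exact: (ny (c'' :: a) b).
by rewrite /= in Ey; case: ry; rewrite Ey; [move/negPn/eqP|rewrite rb eqxx].
Qed.

Lemma node_nil : node [::].
Proof. by split=> [|[|? ?] [|? ?]] //; exact: factor_nil. Qed.

Definition bound := sval (constructive_indefinite_description _ node_bound).

Definition nodes := [seq y <- words A bound | decide (node y)].
Definition code := [seq y <- nodes | return_word y].
Definition inner := [seq y <- nodes | ~~ return_word y].

Lemma mem_nodes y : reflect (node y) (y \in nodes).
Proof.
rewrite mem_filter mem_words; apply: (iffP andP) => [[/decideP]//|ny].
split; first exact/decideP.
by rewrite /bound; case: constructive_indefinite_description => B /= ->.
Qed.

Lemma nodes_uniq : uniq nodes.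
Proof. exact/filter_uniq/words_uniq. Qed.

Lemma mem_code y : reflect [/\ node y, y <> [::] & run o y = o] (y \in code).
Proof.
rewrite mem_filter; apply: (iffP andP) => [[/andP[/eqP ? /eqP ?] /mem_nodes]|[ny y0 ry]] //.
by split; [rewrite /return_word ry eqxx andbT; apply/eqP|exact/mem_nodes].
Qed.

Lemma mem_inner y : reflect (node y /\ ~~ return_word y) (y \in inner).
Proof. by rewrite mem_filter; apply: (iffP andP) => -[] => [?|] /mem_nodes. Qed.

Lemma code_uniq : uniq code.
Proof. exact/filter_uniq/nodes_uniq. Qed.

(** If a word and its prefix fix [o], so does the remaining suffix; thus the condition on suffixes
    also controls prefixes. *)
Lemma code_first_return a b : a ++ b \in code -> run o a = o -> a = [::] \/ b = [::].
Proof.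
move=> /mem_code[[_ nab] _]; rewrite run_cat => rab ra; rewrite ra in rab.
case: a b nab {ra} rab => [|c a] [|c' b] nab; [by left|by left|by right|].
by move=> rb; case: (nab (c :: a) (c' :: b)).
Qed.

Lemma code_bifix : bifix_code code.
Proof.
split; first by move=> x /mem_code[_ /eqP].
split=> x y xC yC.
  case/prefixP=> z Ey; rewrite Ey in yC *; have /mem_code[_ x0 rx] := xC.
  by case: (code_first_return yC rx) => [//|->]; rewrite cats0.
case/suffixP=> z Ey; rewrite Ey in yC *; have /mem_code[_ x0 rx] := xC.
have /mem_code[_ _] := yC; rewrite run_cat -{2}rx => /run_inj rz.
by case: (code_first_return yC rz) => [->|//].
Qed.

(** Cut [w] at a proper nonempty suffix fixing [o] and induct; when there is none, a nonempty [w] is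
    a code word. *)
Lemma factor_return w : F w -> run o w = o -> star code w.
Proof.
move: {2}(size w) (leqnn (size w)) => n; elim: n w => [|n IH] w.
  by rewrite leqn0 => /eqP/size0nil -> _ _; exists [::].
move=> le Fw rw; have [->|/eqP w0] := eqVneq w [::]; first by exists [::].
case: (excluded_middle_informative
  (exists a b, [/\ w = a ++ b, a <> [::], b <> [::] & run o b = o])).
  move=> [a [b [Ew a0 b0 rb]]].
  have ra : run o a = o by move: rw; rewrite Ew run_cat -{2}rb => /run_inj.
  rewrite Ew in Fw le *; move: le; rewrite size_cat => le.
  have : 0 < size a by case: (a) a0.
  have : 0 < size b by case: (b) b0.
  move=> sb sa; apply: star_cat; apply: IH => //; try lia.
    by apply: factor_infix Fw; apply: prefix_infix.
  by apply: factor_infix Fw; apply: suffix_infix.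
move=> no; exists [:: w]; rewrite /= cats0 andbT; split=> //; apply/mem_code; split=> //.
by split=> // a b Ew a0 b0 rb; case: no; exists a, b.
Qed.

(** Every node but the root is counted at its parent, obtained by deleting its first letter. *)
Lemma size_nodes :
  size nodes = (\sum_(y <- inner) count (fun c => decide (F (c :: y))) (enum A)).+1.
Proof.
pose ext y := [seq c <- enum A | decide (F (c :: y))].
have /perm_size -> : perm_eq nodes ([::] :: [seq c :: y | y <- inner, c <- ext y]).
  apply: uniq_perm; first exact: nodes_uniq.
    rewrite /=; apply/andP; split; first by apply/allpairsPdep => -[? [? []]].
    apply: allpairs_uniq_dep; first exact/filter_uniq/nodes_uniq.
      by move=> y _; apply: filter_uniq; exact: enum_uniq.
    by move=> [? ?] [? ?] _ _ [-> ->].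
  move=> [|c y]; first by rewrite inE eqxx; apply/mem_nodes; exact: node_nil.
  rewrite inE /=; apply/mem_nodes/allpairsPdep => [/node_cons[ny ry Fy]|].
    exists y, c; split=> //; first exact/mem_inner.
    by rewrite mem_filter mem_enum andbT; apply/decideP.
  move=> [y' [c' [/mem_inner[ny ry] H [-> ->]]]]; apply/node_cons; split=> //.
  by move: H; rewrite mem_filter => /andP[/decideP].
rewrite /= size_allpairs_dep sumnE big_map; congr _.+1.
by apply: eq_bigr => y _; rewrite size_filter.
Qed.

(** A node in [pref] extends by every letter ([pref_factor]); any other extends by at least one
    ([factor_cons]) and at most one ([factor_special]). *)
Lemma count_ext y : node y ->
  count (fun c => decide (F (c :: y))) (enum A) =
  1 + (if decide (pref l i y) then #|A|.-1 else 0).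
Proof.
move=> [Fy _]; case: decideP => [py|npy].
  rewrite add1n prednK; last by apply/card_gt0P; exists i.
  rewrite (eq_count (a2 := predT)) ?count_predT -?cardE // => c.
  by apply/decideP; exact: pref_factor.
have [c Fc] := factor_cons Fy.
rewrite (eq_count (a2 := pred1 c)).
  by rewrite -/(count_mem c _) count_uniq_mem ?enum_uniq // mem_enum.
move=> c' /=; apply/decideP/eqP => [Fc'|-> //].
by apply/eqP; apply: contraT => ne; case: npy; exact: (factor_special Fc' Fc).
Qed.

Lemma pref_comparable y y' : pref l i y -> pref l i y' -> prefix y y' \/ prefix y' y.
Proof.
have aux n n' z z' : n <= n' -> prefix z (subst l (nseq n i)) ->
    prefix z' (subst l (nseq n' i)) -> prefix z z' \/ prefix z' z.
  move=> nn' pz; rewrite -(subnKC nn') nseqD subst_cat => /prefixP[s Es].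
  have {pz} : prefix z (z' ++ s) by rewrite -Es; exact: prefix_catl.
  rewrite prefixE take_cat; case: ltnP => [lt /eqP Ez|le /eqP Ez].
    by left; rewrite -Ez; exact: prefix_take.
  by right; rewrite -Ez prefix_prefix.
case=> [n py] [n' py']; case: (leqP n n') => [|/ltnW] nn'; first exact: (aux n n').
by case: (aux _ _ _ _ nn' py' py); [right|left].
Qed.

Lemma hits_first t w : hits g o t w -> exists p q,
  [/\ w = p ++ q, run t p = o & forall a b, p = a ++ b -> b <> [::] -> run t a <> o].
Proof.
elim: w t => [|c w IH] t /=; case: eqP => [to|nto] //= h.
- by exists [::], [::]; split=> // -[|? ?] [|? ?].
- by exists [::], (c :: w); split=> // -[|? ?] [|? ?].
have [p [q [-> rp fp]]] := IH _ h; exists (c :: p), q; split=> //.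
by case=> [|c' a] b //= [<- Ep] b0; exact: (fp _ b).
Qed.

Definition start y := (wperm g y)^-1%g o.

Lemma startP y t : start y = t <-> run t y = o.
Proof.
rewrite /start runE; split=> [<-|<-]; [exact: permKV|exact: permK].
Qed.

(* The left special inner nodes correspond to the points [t]: each is the prefix of
   vvv... read from [t] up to the first visit of [o]. *)
Lemma count_pref : count (fun y => decide (pref l i y)) inner = #|T|.
Proof.
rewrite -size_filter; set Q := filter _ _.
have memQ y : reflect [/\ node y, ~~ return_word y & pref l i y] (y \in Q).
  rewrite mem_filter; apply: (iffP andP) => [[/decideP py /mem_inner[]]|[ny ry py]] //.
  by split; [exact/decideP|exact/mem_inner].
have injQ : {in Q &, injective start}.
  (* Two such prefixes are comparable. With a common start the excess [z] fixes [o]: if nonempty, it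
     is a proper suffix forbidden in a node or, for empty [y], a return word. *)
  suff aux y z : y \in Q -> y ++ z \in Q -> start y = start (y ++ z) -> z = [::].
    move=> y y' yQ y'Q E; have /memQ[_ _ py] := yQ; have /memQ[_ _ py'] := y'Q.
    case: (pref_comparable py py') => /prefixP[z Ez]; rewrite Ez in yQ y'Q E *.
      by rewrite (aux _ _ yQ y'Q E) cats0.
    by rewrite (aux _ _ y'Q yQ (esym E)) cats0.
  move=> yQ /memQ[[_ nyz] ryz _] E; apply/eqP; apply: contraT => /eqP z0.
  have /startP r1 := erefl (start y); have /startP r2 := esym E.
  rewrite run_cat r1 in r2.
  case: y => [|c y] in yQ nyz ryz E r1 r2 *; last by case: (nyz (c :: y) z).
  by move: ryz; rewrite /return_word /= r2 eqxx andbT => /negPn/eqP.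
have /perm_size : perm_eq (map start Q) (enum T).
  apply: uniq_perm; [|exact: enum_uniq|move=> t].
    by rewrite map_inj_in_uniq //; do 2!apply: filter_uniq; exact: nodes_uniq.
  rewrite mem_enum; apply/mapP.
  have [p [q [Ew rp fp]]] := hits_first (cover t).
  exists p; last by symmetry; apply/startP.
  have pp : pref l i p by exists m; rewrite subst_nseq Ew prefix_prefix.
  apply/memQ; split=> //; first split.
  - by apply: factor_infix (pref_factor i pp); rewrite /= infix_refl orbT.
  - move=> a b Ep a0 b0 rb; apply: (fp a b) => //.
    by move: rp; rewrite Ep run_cat -{1}rb => /run_inj.
  - apply/andP => -[/eqP p0 /eqP rop]; case: (fp [::] p) => //=.
    by move: rp; rewrite -{1}rop => /run_inj.
by rewrite size_map -cardE.
Qed.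

(** Counted by parents there are [1 + size inner + #|A|.-1 * #|T|] nodes; those that are not inner
    form the code. *)
Lemma size_code : size code = (#|A|.-1 * #|T|).+1.
Proof.
have := size_nodes; rewrite -(count_predC return_word nodes) -!size_filter.
rewrite -/code -[filter (predC _) _]/inner (eq_big_seq _ (fun y yI => count_ext (proj1 (elimT (mem_inner y) yI)))).
rewrite big_split /= sum1_size -big_mkcond /= big_const_seq iter_addn_0 count_pref.
by rewrite addnC -addnS => /addnI.
Qed.

End ReturnCode.

Theorem mainTheorem20 (T : finType) (d k : nat) (G : {group {perm T}}) :
  #|T| = d ->
  [transitive G, on [set: T] | 'P] ->
  (exists gens : k.-tuple {perm T}, (G : {set {perm T}}) = <<[set g in gens]>>%g) ->
  exists X : seq (seq 'I_k),
    [/\ uniq X, bifix_code X,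
        ((size X)%:Z = (k%:Z - 1) * d%:Z + 1)%R &
        is_syntactic_group G X].
Proof.
move=> <- transG [gens].
have -> : [set g in gens] = [set tnth gens c | c : 'I_k].
  apply/setP => x; rewrite inE; apply/tnthP/imsetP => [[c ->]|[c _ ->]]; first by exists c.
  by exists c.
move: (tnth gens) => g {gens} genG.
have [o _] : exists o, o \in [set: T].
  by case/imsetP: transG => o oT _; exists o.
(* Without letters [G] is trivial and, being transitive, acts on one point; the formula gives size
   0, so [X] is empty. *)
case: k g genG => [|k] g genG.
  have no (w : seq 'I_0) : w = [::] by case: w => // -[].
  have oT t : t = o.
    have /orbitP[h] : t \in orbit 'P G o by rewrite (atransP transG) ?inE.
    rewrite genG (_ : [set _ | _ in _] = set0) ?gen0 => [/set1P -> <-|].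
      by rewrite /= /aperm perm1.
    by apply/setP => x; rewrite inE; apply/imsetP => -[[]].
  exists [::]; split=> //.
    have -> : #|T| = 1 by apply: (@eq_card1 _ o) => t; rewrite !inE (oT t) eqxx.
    by [].
  apply: (@cover_is_syntactic_group _ _ g G o _ (fun=> True) [::] (fun c => [:: c])) => //.
  - by move=> w _ _; rewrite (no w); exists [::].
  - by move=> t; rewrite /= (oT t) eqxx.
have [l [i [m [run_l cover]]]] := exists_cover o genG transG ord0.
exists (code cover); split; [exact: code_uniq|exact: code_bifix| |].
  by rewrite size_code card_ord /=; lia.
apply: (cover_is_syntactic_group (g := g) (o := o) (F := factor l i)
  (V := power (subst l [:: i]) m) (u := fun c => subst l [:: c])) => //.
- by move=> x /mem_code[].
- exact: code_first_return.
- exact: factor_infix.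
- exact: factor_return.
- move=> n c; exists (m * n), c.
  by rewrite subst_cat (subst_cons l c (nseq _ _)) subst_nseq powerM infix_refl.
- move=> n; exists (m * n), i.
  by rewrite subst_cat subst_nseq powerM prefix_infix.
Qed.
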